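(* Let $K$ be a compact space. Then $$\mathfrak{pDau}(C(K))=\mathfrak{Dau}(C(K))=\mathfrak{oct}(C(K))=\mathfrak{rig}\text{-}\mathfrak{oct}(C(K))=\mathfrak{r}(K),$$ unless $K$ is a compact space with a $G_\delta$-point but without any isolated point, in which case $$\mathfrak{pDau}(C(K))=\mathfrak{rig}\text{-}\mathfrak{oct}(C(K))=1<\omega=\mathfrak{Dau}(C(K))=\mathfrak{oct}(C(K))=\mathfrak{r}(K).$$
   Context: All topological spaces are Hausdorff and all Banach spaces are real; $C(K)$ is the space of real continuous functions on $K$ with the sup norm. A point $x\in K$ is a $G_\delta$-point if $\{x\}$ is a countable intersection of open sets. $B_X$ and $S_X$ denote the closed unit ball and unit sphere of a Banach space $X$. A slice of $B_X$ is a nonempty intersection of $B_X$ with an open half-space, i.e. a set $\{x\in B_X: f(x)>\sup f(B_X)-\alpha\}$ with $f\in X^*$, $\alpha>0$. For a cardinal $\kappa$ (finite or infinite), $\{y_\alpha:\alpha<\kappa\}$ denotes a set of cardinality at most $\kappa$. $\omega$ is the first infinite cardinal. $X$ has the $\kappa$-Daugavet property if for every family $\{y_\alpha:\alpha<\kappa\}\subseteq S_X$, every slice $S$ of $B_X$ and every $\varepsilon>0$ there is $x\in S$ with $\|y_\alpha+x\|>2-\varepsilon$ for all $\alpha<\kappa$. $X$ has the $\kappa$-perfect Daugavet property if for every family $\{y_\alpha:\alpha<\kappa\}\subseteq S_X$ and every slice $S$ of $B_X$ there is $x\in S$ with $\|y_\alpha+x\|=2$ for all $\alpha<\kappa$.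 $X$ is $\kappa$-octahedral if for every $\{y_\alpha:\alpha<\kappa\}\subseteq S_X$ and every $\varepsilon>0$ there is $x\in S_X$ with $\|y_\alpha\pm x\|>2-\varepsilon$ (both signs) for every $\alpha<\kappa$. $X$ is $\kappa$-rigid octahedral if for every $\{y_\alpha:\alpha<\kappa\}\subseteq S_X$ there is $x\in S_X$ with $\|y_\alpha\pm x\|=2$ (both signs) for every $\alpha<\kappa$. For nonzero $X$, $\mathfrak{Dau}(X)$, $\mathfrak{pDau}(X)$, $\mathfrak{oct}(X)$, $\mathfrak{rig}\text{-}\mathfrak{oct}(X)$ denote the least cardinal $\kappa$ such that $X$ fails, respectively, the $\kappa$-Daugavet property, the $\kappa$-perfect Daugavet property, $\kappa$-octahedrality, $\kappa$-rigid octahedrality. The reaping number $\mathfrak{r}(K)$ of a compact space $K$ is the least cardinality of a family $\mathcal{F}$ of nonempty open subsets of $K$ such that for every two disjoint closed sets $L_1,L_2\subseteq K$ there exists $W\in\mathcal{F}$ with $W\cap L_1=\emptyset$ or $W\cap L_2=\emptyset$. *)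

(* Defs.v *)
From HB Require Import structures.
From mathcomp Require Import all_boot all_order all_algebra.
From mathcomp Require Import all_classical all_reals all_analysis.
From mathcomp Require Import borel_hierarchy lra.

Set Implicit Arguments.
Unset Strict Implicit.
Unset Printing Implicit Defensive.

Import Order.TTheory GRing.Theory Num.Theory.
Import numFieldNormedType.Exports.

Local Open Scope classical_set_scope.
Local Open Scope card_scope.
Local Open Scope ring_scope.

(* The proof of compactness is a parameter of the type because the sup norm
   is a norm only for bounded functions. *)
Definition Cspace (R : realType) (K : topologicalType)
  (cK : compact [set: K]) : Type := continuousType K R.

Section Cspace_theory.
Context (R : realType) (K : topologicalType) (cK : compact [set: K]).
Local Notation CK := (@Cspace R K cK).

HB.instance Definition _ := Choice.on CK.

Definition Cspace_fun (f : CK) : K -> R :=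
  @Continuous.sort K R f.
#[warning="-uniform-inheritance"]
Coercion Cspace_fun : Cspace >-> Funclass.

Definition mkC (f : K -> R) (cf : continuous f) : CK :=
  (mkcts cf : continuousType K R).

Lemma mkCE (f : K -> R) (cf : continuous f) : mkC cf = f :> (K -> R).
Proof. by []. Qed.

Lemma Cspace_continuous (f : CK) : continuous f.
Proof. exact: (@cts_fun K R f). Qed.

Lemma CspaceP (f g : CK) : f =1 g <-> f = g.
Proof. exact: iff_sym (@continuousEP K R f g). Qed.

Let add_cts (f g : CK) : continuous (fun x => f x + g x).
Proof.
by move=> x; apply: (@continuousD R R); exact: Cspace_continuous.
Qed.

Let opp_cts (f : CK) : continuous (fun x => - f x).
Proof. by move=> x; apply: (@continuousN R R); exact: Cspace_continuous. Qed.

Let scale_cts (a : R) (f : CK) : continuous (fun x => a * f x).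
Proof.
by move=> x; apply: continuousM; [exact: cvg_cst|exact: Cspace_continuous].
Qed.

Let zero_cts : continuous (fun _ : K => 0 : R).
Proof. by move=> x; exact: cvg_cst. Qed.

Definition C0 : CK := mkC zero_cts.
Definition Cadd (f g : CK) : CK := mkC (@add_cts f g).
Definition Copp (f : CK) : CK := mkC (@opp_cts f).
Definition Cscale (a : R) (f : CK) : CK := mkC (@scale_cts a f).

Let CaddA : associative Cadd.
Proof. by move=> f g h; apply/CspaceP => x /=; exact: addrA. Qed.
Let CaddC : commutative Cadd.
Proof. by move=> f g; apply/CspaceP => x /=; exact: addrC. Qed.
Let Cadd0 : left_id C0 Cadd.
Proof. by move=> f; apply/CspaceP => x /=; exact: add0r. Qed.
Let CaddN : left_inverse C0 Copp Cadd.
Proof. by move=> f; apply/CspaceP => x /=; exact: addNr. Qed.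

HB.instance Definition _ := GRing.isZmodule.Build CK CaddA CaddC Cadd0 CaddN.

Let CscaleA a b (f : CK) : Cscale a (Cscale b f) = Cscale (a * b) f.
Proof. by apply/CspaceP => x /=; exact: mulrA. Qed.
Let Cscale1 : left_id 1 Cscale.
Proof. by move=> f; apply/CspaceP => x /=; exact: mul1r. Qed.
Let CscaleDr : right_distributive Cscale +%R.
Proof. by move=> a f g; apply/CspaceP => x /=; exact: mulrDr. Qed.
Let CscaleDl (f : CK) : {morph Cscale^~ f : a b / a + b}.
Proof. by move=> a b; apply/CspaceP => x /=; exact: mulrDl. Qed.

HB.instance Definition _ :=
  GRing.Zmodule_isLmodule.Build R CK CscaleA Cscale1 CscaleDr CscaleDl.

Definition Cnorm (f : CK) : R := sup (range (fun x => `|f x|)).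

Lemma Cnorm_has_ubound (f : CK) : has_ubound (range (fun x => `|f x|)).
Proof.
have : compact (range (f : K -> R)).
  apply: continuous_compact => //.
  by apply: continuous_subspaceT; exact: Cspace_continuous.
move=> /compact_bounded [M [Mr Mf]].
exists (M + 1) => _ [x _ <-]; apply: (Mf (M + 1)); first by rewrite ltrDl.
by exists x.
Qed.

Lemma Cnorm_ub (f : CK) (x : K) : `|f x| <= Cnorm f.
Proof. by apply: (ub_le_sup (Cnorm_has_ubound f)); exists x. Qed.

Lemma Cnorm_ge0 (f : CK) : 0 <= Cnorm f.
Proof.
have [[_ [x _ _]]|] := pselect (range (fun x => `|f x|) !=set0).
  exact: le_trans (normr_ge0 _) (Cnorm_ub f x).
by move=> /nonemptyPn h; rewrite /Cnorm h sup0.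
Qed.

Lemma Cnorm_le (f : CK) (M : R) :
  0 <= M -> (forall x, `|f x| <= M) -> Cnorm f <= M.
Proof.
move=> M0 fM.
have [h|] := pselect (range (fun x => `|f x|) !=set0).
  by apply: ge_sup => // _ [x _ <-].
by move=> /nonemptyPn h; rewrite /Cnorm h sup0.
Qed.

Let CnormD (f g : CK) : Cnorm (f + g) <= Cnorm f + Cnorm g.
Proof.
apply: Cnorm_le => [|x]; first by rewrite addr_ge0// Cnorm_ge0.
by rewrite (le_trans (ler_normD _ _))// lerD// Cnorm_ub.
Qed.

Let CnormZ (a : R) (f : CK) : Cnorm (a *: f) = `|a| * Cnorm f.
Proof.
have le b g : Cnorm (b *: g) <= `|b| * Cnorm g.
  apply: Cnorm_le => [|x]; first by rewrite mulr_ge0// Cnorm_ge0.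
  by rewrite [leLHS]normrM ler_wpM2l// Cnorm_ub.
have [->|a0] := eqVneq a 0.
  apply/eqP; rewrite eq_le normr0 mul0r Cnorm_ge0 andbT.
  by rewrite (le_trans (le _ _))// normr0 mul0r.
apply/eqP; rewrite eq_le le/= -ler_pdivlMl ?normr_gt0//.
by rewrite -normfV -{1}(scalerK a0 f) le.
Qed.

Let Cnorm0_eq0 (f : CK) : Cnorm f = 0 -> f = 0.
Proof.
move=> f0; apply/CspaceP => x /=; apply/eqP.
by rewrite -normr_le0 -f0 Cnorm_ub.
Qed.

HB.instance Definition _ :=
  @Lmodule_isNormed.Build R CK Cnorm CnormD CnormZ Cnorm0_eq0.

Lemma CspaceD (f g : CK) (x : K) : (f + g) x = f x + g x.
Proof. by []. Qed.

Lemma CspaceN (f : CK) (x : K) : (- f) x = - f x.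
Proof. by []. Qed.

Lemma CspaceZ (a : R) (f : CK) (x : K) : (a *: f) x = a * f x.
Proof. by []. Qed.

Lemma CnormE (f : CK) : `|f| = sup (range (fun x => `|f x|)).
Proof. by []. Qed.

Let C_complete (F : set_system CK) : ProperFilter F -> cauchy F -> cvg F.
Proof.
move=> FF Fc.
have {}Fc (e : R) : 0 < e -> exists f : CK, \forall h \near F, `|f - h| < e.
  by move=> e0; have /cauchyP/(_ e e0)[f Ff] := Fc; exists f;
    rewrite -ball_normE in Ff.
pose ev x : CK -> R := fun f => f x.
have evc x : cvg (ev x @ F).
  apply: cauchy_cvg; apply: cauchy_exP => e e0.
  have [f Ff] := Fc e e0; exists (f x).
  rewrite -ball_normE; apply: filterS Ff => h /=; apply: le_lt_trans.
  exact: (Cnorm_ub (f - h)).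
pose g x : R := lim (ev x @ F).
have gF (e : R) : 0 < e -> \forall h \near F, forall x, `|(h : CK) x - g x| <= e.
  move=> e0; have [f Ff] := Fc _ (divr_gt0 e0 (ltr0Sn R 1)).
  have fg x : `|f x - g x| <= e / 2.
    have fcv : (fun h : CK => `|f x - ev x h|) @ F --> `|f x - g x|.
      by apply: cvg_norm; apply: cvgB; [exact: cvg_cst|exact: evc].
    rewrite -(cvg_lim (@Rhausdorff R) fcv); apply: limr_le.
      by apply/cvg_ex; eexists; exact: fcv.
    apply: filterS Ff => h /ltW; apply: le_trans.
    exact: (Cnorm_ub (f - h)).
  apply: filterS Ff => h fh x; rewrite (splitr e) (le_trans (ler_distD (f x) _ _))// lerD// distrC.
  by apply/ltW; apply: le_lt_trans fh; exact: (Cnorm_ub (f - h)).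
have cg : continuous g.
  move=> x; apply/cvgrPdist_le => e e0.
  have e3 : 0 < e / 3 by rewrite divr_gt0.
  have [f fg] := filter_ex (gF _ e3).
  have /cvgrPdist_le/(_ _ e3) fx := @Cspace_continuous f x.
  near=> y; have fxy : `|f x - f y| <= e / 3 by near: y.
  have -> : e = e / 3 + (e / 3 + e / 3) by lra.
  rewrite (le_trans (ler_distD (f x) _ _))// lerD//; first by rewrite distrC.
  by rewrite (le_trans (ler_distD (f y) _ _))// lerD.
apply/cvg_ex; exists (mkC cg); apply/cvgrPdist_le => e e0.
near=> h; apply: Cnorm_le => [|x]; first exact: ltW.
have hg : forall x, `|h x - g x| <= e by near: h; exact: gF.
by have := hg x; rewrite distrC.
Unshelve. all: by end_near. Qed.

HB.instance Definition _ := Uniform_isComplete.Build CK C_complete.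

End Cspace_theory.

(* A cardinal is represented by any type of that cardinality; types are
   compared by the library's [card_le], i.e. by injections. *)
Definition cardinal : Type := Type.

(* Least elements are unique only up to equipotence, so the invariants below
   are relations "k is the value of the invariant": two invariants have equal
   values exactly when some k is a value of both. *)
Definition least_cardinal (P : cardinal -> Prop) (k : cardinal) : Prop :=
  P k /\ forall l : cardinal, P l -> [set: k] #<= [set: l].

Section Banach.
Context (R : realType) (X : completeNormedModType R).
Implicit Types (S Y : set X) (k : cardinal).

Definition unit_ball : set X := [set x | `|x| <= 1].

Definition unit_sphere : set X := [set x | `|x| = 1].

Definition slice S : Prop :=
  exists (f : {linear X -> R^o}) (a : R),
    [/\ continuous f, 0 < a &
      S = [set x | unit_ball x /\ sup (f @` unit_ball) - a < f x]].

Definition Daugavet k : Prop :=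
  forall Y, Y `<=` unit_sphere -> Y #<= [set: k] ->
  forall S, slice S -> forall e : R, 0 < e ->
  exists2 x, S x & forall y, Y y -> 2 - e < `|y + x|.

Definition perfect_Daugavet k : Prop :=
  forall Y, Y `<=` unit_sphere -> Y #<= [set: k] ->
  forall S, slice S ->
  exists2 x, S x & forall y, Y y -> `|y + x| = 2.

Definition octahedral k : Prop :=
  forall Y, Y `<=` unit_sphere -> Y #<= [set: k] ->
  forall e : R, 0 < e ->
  exists2 x, unit_sphere x &
    forall y, Y y -> 2 - e < `|y + x| /\ 2 - e < `|y - x|.

Definition rigid_octahedral k : Prop :=
  forall Y, Y `<=` unit_sphere -> Y #<= [set: k] ->
  exists2 x, unit_sphere x &
    forall y, Y y -> `|y + x| = 2 /\ `|y - x| = 2.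

Definition is_Dau k : Prop := least_cardinal (fun l => ~ Daugavet l) k.

Definition is_pDau k : Prop :=
  least_cardinal (fun l => ~ perfect_Daugavet l) k.

Definition is_oct k : Prop := least_cardinal (fun l => ~ octahedral l) k.

Definition is_rig_oct k : Prop :=
  least_cardinal (fun l => ~ rigid_octahedral l) k.

End Banach.

Section Space.
Context (K : topologicalType).

Definition reaping (F : set (set K)) : Prop :=
  (forall W, F W -> open W /\ W !=set0) /\
  forall L1 L2 : set K, closed L1 -> closed L2 -> L1 `&` L2 = set0 ->
    exists2 W, F W & W `&` L1 = set0 \/ W `&` L2 = set0.

Definition is_reaping_number (k : cardinal) : Prop :=
  least_cardinal (fun l => exists2 F, reaping F & F #= [set: l]) k.

Definition has_Gdelta_point : Prop := exists x : K, Gdelta [set x].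

Definition has_isolated_point : Prop := exists x : K, isolated [set: K] x.

End Space.

(* Main.v *)
(* For y in the unit sphere, choose a sign s with s * y attaining 1, and let W_y
   be the open set where s * y > 1 - e (or the G_delta set where s * y = 1). If
   two disjoint closed sets L1, L2 meet every W_y, a Urysohn function equal to 1
   on L1 and -1 on L2 is at distance nearly 2 (or exactly 2) from all y and -y;
   such L1, L2 exist when the sets W_y are too few to form a reaping family.
   For the G_delta sets this costs a factor of omega, absorbed when there are
   infinitely many y; for finitely many y it suffices that nonempty G_delta sets
   are infinite, i.e. that there is no G_delta-point. To stay inside a slice,
   the splitting is iterated, giving a function g with many levels on each W_y,
   and the slice's functional must be nearly insensitive to a perturbation
   living on some pair of consecutive levels. Conversely, functions peaking in
   the members of a reaping family, together with their negatives, witness the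
   failure of all four properties, and one function peaking at a G_delta-point
   destroys the two exact properties. *)
Require Import Defs.
From HB Require Import structures.
From mathcomp Require Import all_boot all_order all_algebra.
From mathcomp Require Import all_classical all_reals all_analysis.
From mathcomp Require Import borel_hierarchy lra.

Set Implicit Arguments.
Unset Strict Implicit.
Unset Printing Implicit Defensive.

Import Order.TTheory GRing.Theory Num.Theory.
Import numFieldNormedType.Exports.

Local Open Scope classical_set_scope.
Local Open Scope card_scope.
Local Open Scope ring_scope.

(** * Cardinal arithmetic by Zorn's lemma *)

Section Cardinals.

Lemma exists_least_card (T : Type) (FF : set (set T)) :
  FF !=set0 -> exists2 A, FF A & forall B, FF B -> A #<= B.
Proof.
move=> FF0.
(* Zorn on sets of choice functions that differ pairwise at every A in FF:
   a maximal one maps onto some A and injects into every B. *)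
pose P (S : set (FF -> T)) :=
  (forall s, S s -> forall A : FF, \val A (s A)) /\
  (forall s t, S s -> S t -> forall A : FF, s A = t A -> s = t).
have [|S [[Sin Sinj] Smax]] := @Zorn_bigcup _ P.
  move=> C CP Ctot; split=> [s [X CX Xs]|s t [X CX Xs] [Z CZ Zt]].
    exact: (CP _ CX).1.
  have [XZ|ZX] := Ctot _ _ CX CZ.
    by apply: (CP _ CZ).2 => //; exact: XZ.
  by apply: (CP _ CX).2 => //; exact: ZX.
(* If no [A] is exhausted by the values of [S], a choice function [f] avoiding all these values
   enlarges [S]. *)
have [A SA] : exists A : FF, forall a, \val A a -> exists2 s, S s & s A = a.
  apply: contrapT => noA.
  have /choice[f fP] : forall A : FF, exists a,
      \val A a /\ forall s, S s -> s A <> a.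
    move=> A; apply: contrapT => nA; apply: noA; exists A => a Aa.
    apply: contrapT => ns; apply: nA; exists a; split=> // s Ss sAa.
    by apply: ns; exists s.
  have [A0 FA0] := FF0.
  apply: (Smax (S `|` [set f])).
    split=> [|SfS]; first exact: subsetUl.
    have : S f by apply: SfS; right.
    by move=> /((fP (SigSub (mem_set FA0))).2 _) /(_ erefl).
  split=> [s [Ss|->] A|s t [Ss|->] [St|->] A //].
  - exact: Sin.
  - exact: (fP A).1.
  - exact: Sinj.
  - by move=> /((fP A).2 _ Ss).
  - by move=> /esym /((fP A).2 _ St).
exists (\val A); first by apply: set_mem; exact: valP.
move=> B FB; pose B' : FF := SigSub (mem_set FB).
apply: (@card_le_trans _ _ _ S).
  apply: card_le_trans (card_image_le (fun s : FF -> T => s A) S).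
  by apply: subset_card_le => a /SA[s Ss <-]; exists s.
have /inj_card_eq/card_eqPle[_ /card_le_trans] :
    {in S &, injective (fun s : FF -> T => s B')}.
  by move=> s t /set_mem Ss /set_mem St; exact: Sinj.
apply; apply: subset_card_le => _ [s Ss <-].
exact: (Sin s Ss B').
Qed.

Lemma card_le_setX_nat (T : choiceType) (A : set T) :
  infinite_set A -> A `*` [set: nat] #<= A.
Proof.
move=> Ainf.
(* Up to a finite remainder, A is partitioned into injective sequences. *)
pose P (D : set (nat -> T)) :=
  (forall d, D d -> injective d /\ forall n, A (d n)) /\
  (forall d e, D d -> D e -> forall n m, d n = e m -> d = e).
have [|D [[Din Ddis] Dmax]] := @Zorn_bigcup _ P.
  move=> C CP Ctot; split=> [s [X CX Xs]|s t [X CX Xs] [Z CZ Zt]].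
    exact: (CP _ CX).1.
  have [XZ|ZX] := Ctot _ _ CX CZ.
    by apply: (CP _ CZ).2 => //; exact: XZ.
  by apply: (CP _ CX).2 => //; exact: ZX.
pose B := A `\` [set a | exists2 d, D d & exists n, d n = a].
(* An infinite remainder would contain an injective sequence, which could be added to [D]. *)
have finB : finite_set B.
  apply: contrapT => /infiniteP/card_leP[f].
  pose g (n : nat) : T := \val (f (SigSub (mem_set (I : [set: nat] n)))).
  have gB n : B (g n) by apply: set_mem; exact: valP.
  have ginj : injective g.
    by move=> m n /val_inj/inj => /(_ (in_setT _) (in_setT _))/(congr1 \val).
  apply: (Dmax (D `|` [set g])).
    split=> [|DgD]; first exact: subsetUl.
    have Dg : D g by apply: DgD; right.
    by have [_] := gB 0%N; apply; exists g => //; exists 0%N.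
  split=> [d [/Din//|->]|d e [Dd|->] [De|->] n m //].
  - by split=> // n; have [] := gB n.
  - exact: Ddis.
  - by move=> dg; have [_] := gB m; case; exists d => //; exists n.
  - by move=> dg; have [_] := gB n; case; exists e => //; exists m.
have [a0 Aa0] := infinite_setN0 Ainf.
have [s sB] : exists s : seq T, B = [set` s] by apply/finite_seqP.
have [d0 Dd0] : exists d, D d.
  apply: contrapT => D0; apply: Ainf; suff -> : A = B by [].
  apply/seteqP; split=> [a Aa|a []//].
  by split=> // -[d Dd]; case: D0; exists d.
(* The natural number codes a triple [(n, c, m)]: [c] selects the [n]-th term of the sequence or the
   [n]-th element of the finite remainder, and [m] is the second coordinate of the target. *)
pose F (x : (nat -> T) * nat) : T * nat :=
  if unpickle x.2 is Some (n, c, m) then (if c then x.1 n else nth a0 s n, m)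
  else (a0, 0%N).
apply: (@card_le_trans _ _ _ (D `*` [set: nat])).
  apply: card_le_trans (card_image_le F _).
  apply: subset_card_le => -[a m] [/= Aa _].
  have [[d Dd [n dn]]|na] :=
      pselect ([set a | exists2 d, D d & exists n, d n = a] a).
    by exists (d, pickle (n, true, m)) => //; rewrite /F/= pickleK/= dn.
  have : [set` s] a by rewrite -sB.
  move=> /= /(nthP a0)[n _ sn].
  by exists (d0, pickle (n, false, m)) => //; rewrite /F/= pickleK/= sn.
have /inj_card_eq/card_eqPle[_ /card_le_trans] :
    {in D `*` [set: nat] &, injective (fun x : (nat -> T) * nat => x.1 x.2)}.
  move=> [d n] [e m] /set_mem[/= Dd _] /set_mem[/= De _] /= dnem.
  have de := Ddis _ _ Dd De _ _ dnem; rewrite -de in dnem *.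
  by rewrite ((Din _ Dd).1 _ _ dnem).
apply; apply: subset_card_le => _ [[d n] [/= Dd _] <-].
exact: (Din _ Dd).2.
Qed.

End Cardinals.

(** * Splitting families of open or G_delta sets in a compact space *)

Section CompactSpaces.
Context (K : topologicalType).
Hypotheses (hK : hausdorff_space K) (cK : compact [set: K]).

Lemma compact_urysohn (R : realType) (A B : set K) :
  closed A -> closed B -> A `&` B = set0 ->
  exists f : K -> R, [/\ continuous f, forall t, 0 <= f t <= 1,
    forall t, A t -> f t = 0 & forall t, B t -> f t = 1].
Proof.
move=> cA cB AB.
have nK : normal_space K by exact: compact_normal.
have [f [cf fA fB f01]] := urysohn_ext_itv nK cA cB AB (@ltr01 R).
exists f; split=> // t.
- by have /= := f01 (f t) (imageT _ _); rewrite in_itv.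
- by move=> At; apply: fA; exists t.
- by move=> Bt; apply: fB; exists t.
Qed.

(** Reduces a G_delta set to countably many open sets. By regularity the [U n] shrink to open [W n]
    with closure inside [U n]; the [V n] are their finite intersections. If [L] meets every [V n],
    the sets [L & V n] form a filter base, and by compactness it clusters at a point of [L] lying in
    every [U n]. *)
Lemma Gdelta_nested (Z : set K) (p : K) : Gdelta Z -> Z p ->
  exists V : nat -> set K, (forall n, open (V n) /\ V n p) /\
    forall L, closed L -> (forall n, L `&` V n !=set0) -> L `&` Z !=set0.
Proof.
move=> [U oU ->] Zp.
have /choice[W WP] : forall n, exists W : set K,
    [/\ open W, W p & closure W `<=` U n].
  move=> n; have Un : nbhs p (U n).
    by apply: open_nbhs_nbhs; split; [exact: oU|exact: Zp].
  have [A nA AU] := compact_regular hK cK filterT Un.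
  exists A°; split; [exact: open_interior|exact: nA|].
  by apply: subset_trans AU; apply: closureS; exact: interior_subset.
pose V n := \bigcap_(i < n.+1) W i.
have Vmono m n : (m <= n)%N -> V n `<=` V m.
  by move=> mn t Vt i /= im; apply: Vt => /=; exact: leq_trans im _.
exists V; split=> [n|L cL LV].
  split; last by move=> i _; case: (WP i).
  rewrite /V bigcap_mkord; elim/big_ind: _ => [|A B|i _].
  - exact: openT.
  - exact: openI.
  - by case: (WP i).
have PF : ProperFilter (filter_from [set: nat] (fun n => L `&` V n)).
  apply: filter_from_proper => //.
  apply: filter_from_filter; first by exists 0%N.
  move=> i j _ _; exists (maxn i j) => // t [Lt Vt].
  by split; split=> //; apply: Vmono Vt; rewrite ?leq_maxl ?leq_maxr.
have [t [_ clt]] := cK PF filterT.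
exists t; split.
  by apply: cL => B Bt; apply: clt => //; exists 0%N => // s [].
move=> n _; have [_ _] := WP n; apply=> B Bt; apply: clt => //.
exists n => // s [_].
by apply => /=.
Qed.

Lemma finite_set_closed_hausdorff (A : set K) : finite_set A -> closed A.
Proof. by move: A; apply/accessible_finite_set_closed/hausdorff_accessible. Qed.

Lemma finite_set_pick (A : set K) (x : K) : finite_set A -> A x ->
  exists2 U, open U & A `&` U = [set x].
Proof.
move=> finA Ax; exists (~` (A `\ x)).
  apply: closed_openC; apply: finite_set_closed_hausdorff.
  exact: finite_setD.
apply/seteqP; split=> [t [At nt]|_ ->]; last by split=> // -[_]; apply.
by apply: contrapT => tx; apply: nt.
Qed.

Lemma no_isolated_infinite (W : set K) :
  ~ has_isolated_point K -> open W -> W !=set0 -> infinite_set W.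
Proof.
move=> nK oW [x Wx] finW; apply: nK; exists x; split; first exact: in_setT.
have [U oU WU] := finite_set_pick finW Wx.
exists (W `&` U); last by rewrite setIT.
apply: open_nbhs_nbhs; split; first exact: openI.
by rewrite WU.
Qed.

Lemma Gdelta_openI (A U : set K) : Gdelta A -> open U -> Gdelta (A `&` U).
Proof.
move=> [F oF ->] oU; exists (fun n => F n `&` U).
  by move=> n; apply: openI.
by rewrite bigcapIl.
Qed.

Lemma no_Gdelta_infinite (Z : set K) :
  ~ has_Gdelta_point K -> Gdelta Z -> Z !=set0 -> infinite_set Z.
Proof.
move=> nK GZ [x Zx] finZ; apply: nK; exists x.
have [U oU <-] := finite_set_pick finZ Zx.
exact: Gdelta_openI.
Qed.

(** For nonempty open sets [W y] this says that they do not form a reaping family. *)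
Definition split_family (I : Type) (Y : set I) (W : I -> set K) :=
  exists L1 L2, [/\ closed L1, closed L2, L1 `&` L2 = set0 &
    forall y, Y y -> W y `&` L1 !=set0 /\ W y `&` L2 !=set0].

(** With [C] the open sets this serves the approximate properties, with [C] the G_delta sets the
    exact ones. *)
Definition splits (C : set (set K)) (I : Type) (Y : set I) :=
  forall W : I -> set K, (forall y, Y y -> C (W y) /\ W y !=set0) ->
  split_family Y W.

(** Each infinite [W y] in turn contributes two new points, one to [A] and one to [B]; finite sets
    are closed. *)
Lemma splits_finite (C : set (set K)) (I : choiceType) (Y : set I) :
  (forall A, C A -> A !=set0 -> infinite_set A) -> finite_set Y -> splits C Y.
Proof.
move=> Cinf /finite_seqP[s ->] W WP.
suff [A [B [finA finB AB WAB]]] : exists A B : set K,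
    [/\ finite_set A, finite_set B, A `&` B = set0 &
     forall y, y \in s -> W y `&` A !=set0 /\ W y `&` B !=set0].
  by exists A, B; split=> //; exact: finite_set_closed_hausdorff.
elim: s WP => [|y s IH] WP.
  by exists set0, set0; split=> //; rewrite setI0.
have [|A [B [finA finB AB WAB]]] := IH.
  by move=> z zs; apply: WP; rewrite /= inE zs orbT.
have Winf : infinite_set (W y).
  by have [] := WP y (mem_head _ _); exact: Cinf.
have finAB : finite_set (A `|` B) by rewrite finite_setU.
have [a [Wa na]] := infinite_setN0 (infinite_setD Winf finAB).
have finABa : finite_set (A `|` B `|` [set a]).
  by rewrite finite_setU; split=> //; exact: finite_set1.
have [b [Wb nb]] := infinite_setN0 (infinite_setD Winf finABa).
exists (A `|` [set a]), (B `|` [set b]); split.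
- by rewrite finite_setU; split=> //; exact: finite_set1.
- by rewrite finite_setU; split=> //; exact: finite_set1.
- rewrite -subset0 => t [[At|->] [Bt|tb]].
  + by rewrite -AB.
  + by apply: nb; left; left; rewrite -tb.
  + by apply: na; right.
  + by apply: nb; right; rewrite -tb.
- move=> z; rewrite inE => /predU1P[->|/WAB[[t [Wt At]] [u [Wu Bu]]]].
    by split; [exists a|exists b]; split=> //; right.
  by split; [exists t|exists u]; split=> //; left.
Qed.

Lemma splits_open (I J : Type) (Y : set I) (l : set J) :
  (forall F : set (set K), reaping F -> ~ (F #<= l)) -> Y #<= l ->
  splits open Y.
Proof.
move=> nF Yl W WP; apply: contrapT => nsplit.
apply: (nF (W @` Y)); last exact: card_le_trans (card_image_le _ _) Yl.
split=> [_ [y /WP ? <-]//|L1 L2 c1 c2 L12].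
apply: contrapT => nW; apply: nsplit; exists L1, L2; split=> // y Yy.
split; apply/set0P/eqP => W0; apply: nW; exists (W y); try by exists y.
  by left.
by right.
Qed.

(** For infinite [Y], each [W y] is replaced by the open sets of [Gdelta_nested], indexed by
    [Y * nat], which is no larger than [Y]. Closed sets meeting all of these meet [W y]. For finite
    [Y], the sets [W y] are infinite. *)
Lemma splits_Gdelta (I : choiceType) (J : Type) (Y : set I) (l : set J) :
  ~ has_Gdelta_point K ->
  (forall F : set (set K), reaping F -> ~ (F #<= l)) -> Y #<= l ->
  splits Gdelta Y.
Proof.
move=> nG nF Yl.
have [finY|infY] := pselect (finite_set Y).
  by apply: splits_finite => // A; exact: no_Gdelta_infinite.
move=> W WP.
have /choice[V VP] : forall y, exists V : nat -> set K, Y y ->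
    (forall n, open (V n) /\ V n !=set0) /\
    forall L, closed L -> (forall n, L `&` V n !=set0) -> L `&` W y !=set0.
  move=> y; have [Yy|nYy] := pselect (Y y); last by exists (fun=> setT).
  have [GW [p Wp]] := WP _ Yy.
  have [V [oV VL]] := Gdelta_nested GW Wp.
  by exists V => _; split=> // n; have [? ?] := oV n; split=> //; exists p.
have Ynat := splits_open nF (card_le_trans (card_le_setX_nat infY) Yl).
have [|L1 [L2 [c1 c2 L12 LV]]] := Ynat (fun yn => V yn.1 yn.2).
  by move=> [y n] [/= /VP[+ _] _]; apply.
exists L1, L2; split=> // y Yy; have [_ WL] := VP _ Yy.
by split; rewrite setIC; apply: WL => // n; rewrite setIC;
  have [] := LV (y, n) (conj Yy Logic.I).
Qed.

End CompactSpaces.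

(** * Bump functions on the line around integer levels *)

Section Slices.
Context (R : realType).

Definition clamp (u : R) : R := Num.max 0 (Num.min 1 u).

Lemma clamp_itv u : 0 <= clamp u <= 1.
Proof.
by rewrite /clamp le_max lexx/= ge_max ler01/= ge_min lexx.
Qed.

Lemma clamp_eq1 u : 1 <= u -> clamp u = 1.
Proof. by move=> u1; rewrite /clamp min_l// max_r. Qed.

Lemma clamp_eq0 u : u <= 0 -> clamp u = 0.
Proof. by move=> u0; rewrite /clamp max_l// ge_min u0 orbT. Qed.

Lemma clamp_continuous : continuous clamp.
Proof.
move=> u; apply: (@continuous_max R R (cst 0) (fun v => Num.min 1 v)).
  exact: cvg_cst.
apply: (@continuous_min R R (cst 1) id); first exact: cvg_cst.
exact: cvg_id.
Qed.

(** A trapezoid: its plateau has radius 1/4, the tolerance in [levels], and its support has radius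
    1/2, so that bumps at distinct integers do not overlap. *)
Definition bump (c u : R) : R := clamp (2 - 4 * `|u - c|).

Lemma bump_itv c u : 0 <= bump c u <= 1.
Proof. exact: clamp_itv. Qed.

Lemma bump_eq1 c u : `|u - c| <= 1 / 4 -> bump c u = 1.
Proof. by move=> uc; apply: clamp_eq1; lra. Qed.

Lemma bump_eq0 c u : 1 / 2 <= `|u - c| -> bump c u = 0.
Proof. by move=> uc; apply: clamp_eq0; lra. Qed.

Lemma bump_continuous c : continuous (bump c).
Proof.
move=> u; apply: (@continuous_comp _ _ _ (fun u => 2 - 4 * `|u - c|) clamp);
  last exact: clamp_continuous.
apply: cvgB; first exact: cvg_cst.
apply: cvgM; first exact: cvg_cst.
apply: cvg_norm; apply: cvgB; first exact: cvg_id.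
exact: cvg_cst.
Qed.

(** Cut-off to the band of the levels 2j and 2j+1; [wave] passes from 1 to -1 inside this band. *)
Definition bump2 (j : nat) (u : R) : R :=
  bump (2 * j%:R) u + bump (2 * j%:R + 1) u.

Definition wave (j : nat) (u : R) : R :=
  bump (2 * j%:R) u - bump (2 * j%:R + 1) u.

Lemma bump2_itv j u : 0 <= bump2 j u <= 1.
Proof.
rewrite /bump2; have := bump_itv (2 * j%:R) u.
have := bump_itv (2 * j%:R + 1) u.
have [uj|uj] := leP u (2 * j%:R + 1 / 2); last first.
  rewrite (@bump_eq0 (2 * j%:R) u); first lra.
  by rewrite ger0_norm; lra.
rewrite (@bump_eq0 (2 * j%:R + 1) u); first lra.
by rewrite ler0_norm; lra.
Qed.

Lemma wave_le j u : `|wave j u| <= bump2 j u.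
Proof.
rewrite /bump2 /wave; have := bump_itv (2 * j%:R) u.
have := bump_itv (2 * j%:R + 1) u.
by move=> /andP[? ?] /andP[? ?]; rewrite ler_norml; apply/andP; split; lra.
Qed.

Lemma sum_bump2 n u : \sum_(j < n) bump2 j u <= 1.
Proof.
elim: n => [|n IH]; first by rewrite big_ord0.
rewrite big_ord_recr/=.
(* The point 2n - 1/2 separates the last band from all earlier ones. *)
have [un|un] := leP u (2 * n%:R - 1 / 2).
  rewrite {2}/bump2 !bump_eq0 ?addr0//; rewrite ler0_norm; lra.
rewrite big1 ?add0r; first by case/andP: (bump2_itv n u).
move=> j _; have jn : (j%:R : R) + 1 <= n%:R.
  by rewrite natr1 ler_nat; exact: ltn_ord.
by rewrite /bump2 !bump_eq0 ?addr0//; rewrite ger0_norm; lra.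
Qed.

End Slices.

(** * Functions in a slice that take both values 1 and -1 on every [W y] *)

Section SlicesOfC.
Context (R : realType) (K : topologicalType).
Hypotheses (hK : hausdorff_space K) (cK : compact [set: K]).
Local Notation CK := (@Cspace R K cK).

(** By induction: the parts of the [W y] at the top level [n] are again in [C], so closed sets [L1],
    [L2] split them. Adding a Urysohn function lifts the points of [L2] to level n+1 and leaves
    those of [L1] at level n. *)
Lemma levels (C : set (set K)) (I : Type) (Y : set I) (W : I -> set K) :
  (forall A U, C A -> open U -> C (A `&` U)) -> splits C Y ->
  (forall y, Y y -> C (W y) /\ W y !=set0) ->
  forall n, exists2 g : K -> R, continuous g &
    forall i, (i <= n)%N -> forall y, Y y ->
    W y `&` [set t | `|g t - i%:R| < 1 / 4] !=set0.
Proof.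
move=> CU CY WP; elim=> [|n [g cg gW]].
  exists (fun=> 0); first by move=> t; exact: cvg_cst.
  move=> i; rewrite leqn0 => /eqP -> y /WP[_ [t Wt]]; exists t; split=> //=.
  by rewrite subrr normr0; lra.
pose U := [set t | `|g t - n%:R| < 1 / 4].
have oU : open U.
  have -> : U = (fun t => `|g t - n%:R|) @^-1` [set u | u < 1 / 4] by [].
  apply: open_comp; last exact: open_lt.
  move=> t _; apply: cvg_norm; apply: cvgB; first exact: cg.
  exact: cvg_cst.
have [y Yy|L1 [L2 [c1 c2 L12 WL]]] := CY (fun y => W y `&` U).
  by split; [by apply: CU => //; case: (WP _ Yy)|exact: gW].
have [h [ch h01 h0 h1]] := compact_urysohn hK cK R c1 c2 L12.
(* The cut-off is 1 where g >= n - 1/4 and 0 where g <= n - 1/2, so the lower levels do not move. *)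
pose phi t := clamp (4 * (g t - n%:R) + 2).
have phi1 t : `|g t - n%:R| < 1 / 4 -> phi t = 1.
  by rewrite ltr_norml => /andP[? ?]; apply: clamp_eq1; lra.
exists (fun t => g t + h t * phi t).
  move=> t; apply: cvgD; first exact: cg.
  apply: cvgM; first exact: ch.
  apply: (@continuous_comp _ _ _ (fun t => 4 * (g t - n%:R) + 2) (@clamp R));
    last exact: clamp_continuous.
  apply: cvgD; last exact: cvg_cst.
  apply: cvgM; first exact: cvg_cst.
  by apply: cvgB; [exact: cg|exact: cvg_cst].
move=> i; rewrite leq_eqVlt => /predU1P[->|]; last first.
  rewrite ltnS leq_eqVlt => /predU1P[->|ltin] y Yy.
    have [[t [[Wt Ut] Lt]] _] := WL _ Yy; exists t; split=> //=.
    by rewrite h0// mul0r addr0.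
  have [t [Wt gt]] := gW i (ltnW ltin) y Yy; exists t; split=> //=.
  have {}ltin : (i%:R : R) + 1 <= n%:R by rewrite natr1 ler_nat.
  rewrite /phi clamp_eq0 ?mulr0 ?addr0//.
  by move: gt => /=; rewrite ltr_norml => /andP[? ?]; lra.
move=> y Yy; have [_ [t [[Wt Ut] Lt]]] := WL _ Yy; exists t; split=> //=.
rewrite h1// phi1// mul1r -natr1; move: Ut; rewrite /U/=.
by congr (`|_| < _); lra.
Qed.

(** Radius 2 is the bound on the sum of perturbations in [slice_attains]. *)
Lemma linear_bounded_ball (X : normedModType R) (f : {linear X -> R^o}) :
  continuous f -> exists2 M : R, 0 < M & forall x, `|x| <= 2 -> `|f x| <= M.
Proof.
move=> /linear_bounded_continuous/bounded_funP/(_ 2)[M fM].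
by exists (`|M| + 1) => [|x /fM/le_trans]; [exact: ltr_wpDl|apply];
  rewrite ler_wpDr// ler_norm.
Qed.

Lemma slice_nonempty (X : completeNormedModType R) (S : set X) :
  slice S -> S !=set0.
Proof.
move=> [f [a [cf a0 ->]]].
have [M _ fM] := linear_bounded_ball cf.
have [|_ [x Bx <-] fx] := @sup_adherent R (f @` (@unit_ball R X)) _ a0.
  split; first by exists (f 0), 0 => //; rewrite /unit_ball/= normr0.
  exists M => _ [x Bx <-]; apply: le_trans (ler_norm _) _.
  by apply: fM; apply: le_trans Bx _; lra.
by exists x.
Qed.

Lemma Csum_eval n (d : 'I_n -> CK) (t : K) :
  (\sum_(j < n) d j : CK) t = \sum_(j < n) d j t.
Proof. by elim/big_rec2: _ => // j u v _ <-. Qed.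

(* Oscillating a point of the slice inside one of many pairwise disjoint level
   bands of g gives perturbations whose sum has norm at most 2, so the
   functional cannot decrease substantially along all of them. *)
Lemma slice_attains (C : set (set K)) (I : Type) (Y : set I) (W : I -> set K)
    (S : set CK) :
  (forall A U, C A -> open U -> C (A `&` U)) -> splits C Y ->
  (forall y, Y y -> C (W y) /\ W y !=set0) -> slice S ->
  exists2 x : CK, S x & forall y, Y y ->
    (exists2 t, W y t & x t = 1) /\ (exists2 t, W y t & x t = -1).
Proof.
move=> CU CY WP sS; have [x0 Sx0] : exists x0 : CK, S x0 := slice_nonempty sS.
move: sS Sx0 => [f [a [cf a0 ->]]] [/= Bx0 fx0].
set s := sup _ in fx0 *.
have [M M0 fM] := linear_bounded_ball cf.
pose delta := f x0 - (s - a).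
have delta0 : 0 < delta by rewrite subr_gt0.
(* So many bands that losing [delta] on each of them would exceed the bound [M]; they occupy the
   levels up to 2N. *)
pose N := Num.bound (M / delta).
have NM : M < N%:R * delta.
  by rewrite -ltr_pdivrMr//; apply: archi_boundP; rewrite divr_ge0// ltW.
have [g cg gW] := levels CU CY WP (2 * N).
have x0t t : `|x0 t| <= 1 by exact: le_trans (Cnorm_ub x0 t) Bx0.
(* In band [j], [x0] is faded out and replaced by the wave; as |wave| <= [bump2], the result stays
   in the unit ball. *)
have cx j : continuous (fun t => (1 - bump2 j (g t)) * x0 t + wave j (g t)).
  have cb c : continuous (fun t => bump c (g t)).
    move=> t; apply: (@continuous_comp _ _ _ g (bump c)); first exact: cg.
    exact: bump_continuous.
  move=> t; apply: cvgD; last by apply: cvgB; exact: cb.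
  apply: cvgM; last exact: Cspace_continuous.
  by apply: cvgB; [exact: cvg_cst|apply: cvgD; exact: cb].
pose x j : CK := mkC cK (cx j).
have xE j t : x j t = (1 - bump2 j (g t)) * x0 t + wave j (g t) by [].
have Bx j : `|x j| <= 1.
  apply: Cnorm_le => // t; rewrite xE; apply: le_trans (ler_normD _ _) _.
  have /andP[b0 b1] := bump2_itv j (g t); have := wave_le j (g t).
  rewrite normrM ger0_norm ?subr_ge0//.
  have : (1 - bump2 j (g t)) * `|x0 t| <= 1 - bump2 j (g t).
    by rewrite ler_piMr ?subr_ge0.
  lra.
have [j jN fxj] : exists2 j, (j < N)%N & s - a < f (x j).
  apply: contrapT => nx.
  have fd j : (j < N)%N -> f (x j - x0) <= - delta.
    move=> jN; rewrite linearB/= lerBlDr /delta opprB subrK leNgt.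
    by apply/negP => fxj; apply: nx; exists j.
  (* Pointwise |x j - x0| <= 2 * [bump2 j], and the [bump2 j] sum to at most 1, so |d| <= 2; but
     f(d) <= -N * delta < -M. *)
  pose d : CK := \sum_(j < N) (x j - x0).
  have d2 : `|d| <= 2.
    apply: Cnorm_le => // t; rewrite Csum_eval.
    apply: le_trans (ler_norm_sum _ _ _) _.
    apply: (@le_trans _ _ (\sum_(j < N) 2 * bump2 j (g t))); last first.
      by rewrite -mulr_sumr; have := sum_bump2 N (g t); lra.
    apply: ler_sum => j _; rewrite -[leLHS]/(`|x j t - x0 t|) xE.
    have -> : (1 - bump2 j (g t)) * x0 t + wave j (g t) - x0 t =
      wave j (g t) - bump2 j (g t) * x0 t by lra.
    apply: le_trans (ler_normB _ _) _; have := wave_le j (g t).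
    have /andP[b0 _] := bump2_itv j (g t).
    have : `|bump2 j (g t) * x0 t| <= bump2 j (g t).
      by rewrite normrM ger0_norm// ler_piMr.
    lra.
  have : f d <= - (N%:R * delta).
    rewrite /d linear_sum/=.
    apply: (@le_trans _ _ (\sum_(j < N) - delta)).
      by apply: ler_sum => j _; exact: fd.
    by rewrite sumr_const card_ord mulNrn -[delta *+ N]mulr_natl.
  have := fM _ d2; rewrite ler_norml => /andP[fd' _].
  by move: (f d) fd' => fd' ? ?; lra.
exists (x j); first by split=> //; exact: Bx.
move=> y Yy.
have jN1 : ((2 * j).+1 <= 2 * N)%N.
  by rewrite (leq_trans _ (_ : 2 * j.+1 <= _)%N) ?leq_mul2l// mulnS add2n.
have [t [Wt gt]] := gW _ (ltnW jN1) y Yy.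
have [u [Wu gu]] := gW _ jN1 y Yy.
split.
  exists t => //; rewrite xE /wave /bump2.
  move: gt; rewrite /= natrM => gt.
  rewrite bump_eq1 ?ltW// bump_eq0 ?subr0; first by lra.
  by move: gt; rewrite ltr_norml => /andP[? ?]; rewrite ler0_norm; lra.
exists u => //; rewrite xE /wave /bump2.
move: gu; rewrite /= -natr1 natrM => gu.
rewrite (@bump_eq1 _ (2 * j%:R + 1)) ?ltW// bump_eq0; first by lra.
by move: gu; rewrite ltr_norml => /andP[? ?]; rewrite ger0_norm; lra.
Qed.

End SlicesOfC.

(** * Norm attainment and peak functions *)

Section NormOfC.
Context (R : realType) (K : topologicalType).
Hypotheses (hK : hausdorff_space K) (cK : compact [set: K]).
Local Notation CK := (@Cspace R K cK).

Lemma Cnorm_attained (f : CK) :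
  [set: K] !=set0 -> exists t, `|f| = `|f t|.
Proof.
move=> K0.
have cf : {within [set: K], continuous (fun t => `|f t|)}.
  apply: continuous_subspaceT => t; apply: cvg_norm.
  exact: Cspace_continuous.
have [t _ ft] := compact_EVT_max K0 cK cf.
exists t; apply/eqP; rewrite eq_le; apply/andP; split.
  by apply: Cnorm_le => // s; apply: ft; rewrite inE.
exact: Cnorm_ub.
Qed.

Lemma Cnorm_gt (f : CK) (r : R) :
  [set: K] !=set0 -> r < `|f| -> exists t, r < `|f t|.
Proof. by move=> /(Cnorm_attained f)[t ->] ?; exists t. Qed.

Lemma Cnorm_eq1 (f : CK) (t : K) :
  (forall s, `|f s| <= 1) -> `|f t| = 1 -> `|f| = 1.
Proof.
move=> f1 ft; apply/eqP; rewrite eq_le; apply/andP; split.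
  exact: Cnorm_le.
by rewrite -ft; exact: Cnorm_ub.
Qed.

Lemma open_peak (W : set K) : open W -> W !=set0 -> exists y : CK,
  [/\ `|y| = 1, forall t, 0 <= y t <= 1 & forall t, ~ W t -> y t = 0].
Proof.
move=> oW [p Wp].
have [|h [ch h01 h0 h1]] := compact_urysohn hK cK R (open_closedC oW)
    (finite_set_closed_hausdorff hK (finite_set1 p)).
  by rewrite -subset0 => t [/= nWt tp]; apply: nWt; rewrite tp.
exists (mkC cK ch); split=> //.
apply: (@Cnorm_eq1 _ p) => [s|]; rewrite mkCE.
  by have /andP[? ?] := h01 s; rewrite ger0_norm.
by rewrite h1// normr1.
Qed.

(** If [h n] vanishes at [p] and is 1 off [U n], the sum [z] of the 2^-n * h n vanishes exactly at
    [p], and 1 - z, clamped to stay nonnegative, peaks only there. *)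
Lemma Gdelta_point_peak (p : K) : Gdelta [set p] -> exists y : CK,
  [/\ `|y| = 1, forall t, 0 <= y t & forall t, 1 <= y t -> t = p].
Proof.
move=> [U oU pU].
have /choice[h hP] : forall n, exists h : CK,
    [/\ forall t, 0 <= h t <= 1, h p = 0 & forall t, ~ U n t -> h t = 1].
  move=> n.
  have [|h [ch h01 h0 h1]] := compact_urysohn hK cK R
      (finite_set_closed_hausdorff hK (finite_set1 p)) (open_closedC (oU n)).
    rewrite -subset0 => t [/= -> ]; apply.
    by have : [set p] p by []; rewrite pU => /(_ n Logic.I).
  by exists (mkC cK ch); split=> //; exact: h0.
pose u n : CK := (2^-1 ^+ n) *: h n.
have uE n t : u n t = 2^-1 ^+ n * h n t by [].
have u0 n t : 0 <= u n t.
  rewrite uE mulr_ge0 ?exprn_ge0 ?invr_ge0//.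
  by have [/(_ t)/andP[]] := hP n.
have cu : cvgn (series u).
  apply: normed_cvg.
  apply: (@series_le_cvg _ _ (geometric 1 2^-1)).
  - by move=> n /=.
  - by move=> n /=; rewrite mul1r exprn_ge0// invr_ge0.
  - move=> n; rewrite /= mul1r; apply: Cnorm_le => [|t].
      by rewrite exprn_ge0// invr_ge0.
    rewrite ger0_norm// uE ler_piMr ?exprn_ge0 ?invr_ge0//.
    by have [/(_ t)/andP[]] := hP n.
  - apply: is_cvg_geometric_series.
    by rewrite ger0_norm ?invr_ge0// invf_lt1// ltr1n.
pose z : CK := limn (series u).
have zt t : (fun n => (series u n : CK) t) @ \oo --> z t.
  apply/cvgrPdist_le => e e0.
  have /cvgrPdist_le/(_ e e0) := cu.
  apply: filterS => n; apply: le_trans; exact: (Cnorm_ub (z - series u n : CK)).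
have sE n t : (series u n : CK) t = \sum_(0 <= k < n) u k t.
  by rewrite /series/=; elim/big_rec2: _ => // j v w _ <-.
have zp : z p = 0.
  have sp0 : (fun n => (series u n : CK) p) = cst 0.
    apply/funext => n; rewrite sE big1// => k _; rewrite uE.
    by have [_ -> _] := hP k; rewrite mulr0.
  have := zt p; rewrite sp0 => z0.
  rewrite -(cvg_lim (@Rhausdorff R) z0).
  exact: (cvg_lim (@Rhausdorff R) (cvg_cst _)).
(* The terms are nonnegative, so each one is a lower bound of the sum. *)
have z0 t n : u n t <= z t.
  rewrite -(cvg_lim (@Rhausdorff R) (zt t)); apply: limr_ge.
    by apply/cvg_ex; eexists; exact: zt.
  exists n.+1 => // m /= nm.
  rewrite sE (big_cat_nat _ nm)//= big_nat_recr//=.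
  rewrite [X in X + _]addrC -addrA lerDl.
  by apply: addr_ge0; apply: sumr_ge0 => i _; exact: u0.
have cy : continuous (fun t => clamp (1 - z t)).
  move=> t; apply: (@continuous_comp _ _ _ (fun t => 1 - z t) (@clamp R));
    last exact: clamp_continuous.
  by apply: cvgB; [exact: cvg_cst|exact: Cspace_continuous].
exists (mkC cK cy); split.
- apply: (@Cnorm_eq1 _ p) => [s|]; rewrite mkCE.
    by have /andP[? ?] := clamp_itv (1 - z s); rewrite ger0_norm.
  by rewrite zp subr0 clamp_eq1// normr1.
- by move=> t; have /andP[] := clamp_itv (1 - z t).
- move=> t; rewrite mkCE => yt.
  suff : [set p] t by [].
  rewrite pU => n _; apply: contrapT => nU.
  have := z0 t n; rewrite uE; have [_ _ ->//] := hP n.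
  rewrite mulr1; have : 0 < (2^-1 : R) ^+ n by rewrite exprn_gt0// invr_gt0.
  move=> e0 ez; move: yt; rewrite /clamp le_max ler10/= le_min => /andP[_]; lra.
Qed.

End NormOfC.

(** * Slices given by evaluation at a point *)

Section Evaluation.
Context (R : realType) (K : topologicalType) (cK : compact [set: K]).
Local Notation CK := (@Cspace R K cK).

(** The minus sign makes the slice consist of functions negative at [p], opposed to a positive peak
    there. *)
Definition Ceval (p : K) (f : CK) : R^o := - f p.

Let Ceval_linear p : linear (Ceval p).
Proof. by move=> a f g; rewrite /Ceval scalerN -opprD. Qed.

HB.instance Definition _ p :=
  GRing.isLinear.Build R CK R^o *:%R (Ceval p) (Ceval_linear p).

Let Ccst_continuous (a : R) : continuous (fun _ : K => a).
Proof. by move=> x; exact: cvg_cst. Qed.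

Definition Ccst (a : R) : CK := mkC cK (@Ccst_continuous a).

Lemma Ceval_continuous p : continuous (Ceval p).
Proof.
apply/linear_bounded_continuous/bounded_funP => r; exists r => f.
by apply: le_trans; rewrite normrN; exact: Cnorm_ub.
Qed.

(** The constant -1 shows that the supremum of the functional on the ball is at least 1; the slice
    has depth 1/2. *)
Lemma slice_eval (p : K) : exists2 S : set CK, slice S &
  forall x, S x -> `|x| <= 1 /\ x p < - (1 / 2).
Proof.
exists [set x | unit_ball x /\
  sup (Ceval p @` @unit_ball R CK) - 1 / 2 < Ceval p x].
  by exists (Ceval p), (1 / 2); split=> //; exact: Ceval_continuous.
move=> x [Bx]; rewrite /Ceval => px; split=> //.
suff : 1 <= sup (Ceval p @` @unit_ball R CK).
  by move: px; set s := sup _; lra.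
apply: ub_le_sup.
  exists 1 => _ [y By <-]; apply: le_trans (ler_norm _) _.
  by rewrite normrN; apply: le_trans By; exact: Cnorm_ub.
exists (Ccst (-1)); last by rewrite /Ceval opprK.
by apply: Cnorm_le => // t; rewrite normrN normr1.
Qed.

End Evaluation.

(** * Upper bounds: reaping families and G_delta-points defeat the properties *)

Section Octahedrality.
Context (R : realType) (K : topologicalType).
Hypotheses (hK : hausdorff_space K) (cK : compact [set: K]).
Hypothesis K0 : [set: K] !=set0.
Local Notation CK := (@Cspace R K cK).

Lemma reaping_neq0 (F : set (set K)) : reaping F -> F !=set0.
Proof.
move=> [_ /(_ set0 set0)] []; [exact: closed0|exact: closed0|exact: setI0|].
by move=> W FW _; exists W.
Qed.

(** Without isolated points nonempty open sets are infinite, so finitely many of them can be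
    split. *)
Lemma reaping_infinite (F : set (set K)) :
  ~ has_isolated_point K -> reaping F -> infinite_set F.
Proof.
move=> nK [oF rF] finF.
have Oinf (A : set K) : open A -> A !=set0 -> infinite_set A.
  exact: no_isolated_infinite.
have [L1 [L2 [c1 c2 L12 FL]]] := splits_finite hK Oinf finF (W := id) oF.
have [W FW] := rF _ _ c1 c2 L12.
by have [/set0P/eqP ? /set0P/eqP ?] := FL _ FW; case.
Qed.

Lemma isolated_open (p : K) : isolated [set: K] p -> open [set p].
Proof.
move=> [_ [V Vp]]; rewrite setIT => VE.
by rewrite openE => _ ->; rewrite /interior -VE.
Qed.

Lemma isolated_reaping (p : K) : isolated [set: K] p -> reaping [set [set p]].
Proof.
move=> ip; split=> [_ ->|L1 L2 _ _ L12].
  by split; [exact: isolated_open|exists p].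
exists [set p] => //; have [L1p|nL1p] := pselect (L1 p).
  by right; rewrite -subset0 => t [-> L2p]; rewrite -L12.
by left; rewrite -subset0 => t [-> /nL1p].
Qed.

(** A closed set meeting every [V n] contains [p], which two disjoint sets cannot both do. *)
Lemma Gdelta_point_reaping (p : K) : Gdelta [set p] ->
  exists2 F : set (set K), reaping F & countable F.
Proof.
move=> Gp; have [V [oV VL]] := Gdelta_nested hK cK Gp (erefl : [set p] p).
exists (range V); last first.
  exact: card_le_trans (card_image_le _ _) (countableP _).
split=> [_ [n _ <-]|L1 L2 c1 c2 L12].
  by have [? ?] := oV n; split=> //; exists p.
apply: contrapT => nF.
have Lp L : closed L -> (forall n, V n `&` L <> set0) -> L p.
  move=> cL LV; have [n|t [Lt <-]//] := VL L cL.
  by rewrite setIC; apply/set0P/eqP.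
have : set0 p; last by [].
rewrite -L12; split; apply: Lp => // n Vn; apply: nF; exists (V n);
  try by exists n.
  by left.
by right.
Qed.

Lemma peaks (F : set (set K)) : reaping F -> exists y : set K -> CK,
  forall W, F W -> [/\ `|y W| = 1, forall t, 0 <= y W t <= 1 &
    forall t, ~ W t -> y W t = 0].
Proof.
move=> [oF _].
have /choice[y yP] : forall W, exists y : CK, F W ->
    [/\ `|y| = 1, forall t, 0 <= y t <= 1 & forall t, ~ W t -> y t = 0].
  move=> W; have [FW|nFW] := pselect (F W); last by exists 0.
  by have [oW W0] := oF _ FW; have [y ?] := open_peak R hK cK oW W0; exists y.
by exists y.
Qed.

(** Some [W] misses {x >= 1/2} or {x <= -1/2}. Since 0 <= y <= 1 and |x| <= 1, the two norm bounds
    would give points of [W] with x > 1/2 and with x < -1/2. *)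
Lemma reaping_no_oscillation (F : set (set K)) (y : set K -> CK) (x : CK) :
  reaping F ->
  (forall W, F W -> [/\ `|y W| = 1, forall t, 0 <= y W t <= 1 &
    forall t, ~ W t -> y W t = 0]) ->
  `|x| <= 1 ->
  ~ forall W, F W -> 3 / 2 < `|y W + x| /\ 3 / 2 < `|y W - x|.
Proof.
move=> rF yP x1 yx.
have cx : continuous x by exact: Cspace_continuous.
have [|||W FW] := rF.2 [set t | 1 / 2 <= x t] [set t | x t <= - (1 / 2)].
- rewrite (_ : [set t | 1 / 2 <= x t] = x @^-1` [set u | 1 / 2 <= u])//.
  by apply: closed_comp; [move=> t _; exact: cx|exact: closed_ge].
- rewrite (_ : [set t | x t <= - (1 / 2)] = x @^-1` [set u | u <= - (1 / 2)])//.
  by apply: closed_comp; [move=> t _; exact: cx|exact: closed_le].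
- by rewrite -subset0 => t [/= ? ?]; lra.
have [_ y01 yW] := yP _ FW; have [yx1 yx2] := yx _ FW.
have x1t t : - 1 <= x t <= 1.
  by rewrite -ler_norml; apply: le_trans x1; exact: Cnorm_ub.
have Wt t : 0 < y W t -> W t.
  by move=> yt; apply: contrapT => /yW y0; move: yt; rewrite y0 ltxx.
have [t yxt] : exists t, 3 / 2 < `|y W t + x t| by exact: Cnorm_gt yx1.
have [u yxu] : exists u, 3 / 2 < `|y W u - x u| by exact: Cnorm_gt yx2.
have /andP[? ?] := y01 t; have /andP[? ?] := y01 u.
have /andP[? ?] := x1t t; have /andP[? ?] := x1t u.
have t32 : 3 / 2 < y W t + x t.
  by move: yxt; rewrite lter_normr => /orP[//|]; lra.
have u32 : 3 / 2 < y W u - x u.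
  by move: yxu; rewrite lter_normr => /orP[//|]; lra.
have Wt' : W t by apply: Wt; lra.
have Wu' : W u by apply: Wt; lra.
case; apply/eqP/set0P.
  by exists t; split=> //=; lra.
by exists u; split=> //=; lra.
Qed.

Lemma reaping_not_octahedral (F : set (set K)) (k : cardinal) :
  reaping F -> F #<= [set: k] -> ~ octahedral CK k.
Proof.
move=> rF Fk oct; have [y yP] := peaks rF.
have [|||x x1 yx] := oct (y @` F) _ _ (1 / 2).
- by move=> _ [W /yP[? _ _] <-].
- exact: card_le_trans (card_image_le _ _) Fk.
- by lra.
apply: (@reaping_no_oscillation F y x) => //; first by rewrite x1.
move=> W FW; have [|] := yx (y W); first by exists W.
by split; lra.
Qed.

(** The Daugavet property controls only |y + x|, so the functions -y are added to the family; this
    is free when [F] is infinite. At an isolated point a single peak and an opposing slice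
    suffice. *)
Lemma reaping_not_Daugavet (F : set (set K)) (k : cardinal) :
  reaping F -> F #<= [set: k] -> ~ Daugavet CK k.
Proof.
move=> rF Fk Dau.
have [[p ip]|nK] := pselect (has_isolated_point K).
  have [|y [y1 y01 yp]] := open_peak R hK cK (isolated_open ip).
    by exists p.
  have [S sS SP] := slice_eval R cK p.
  have [x Sx yx] : exists2 x : CK, S x &
      forall z, [set y] z -> 2 - 1 / 2 < `|z + x|.
    apply: Dau => // [_ ->//|].
    have [W FW] := reaping_neq0 rF.
    apply: card_le_trans Fk; apply: (@card_le_trans _ _ _ [set W]).
      by have /card_eqPle[] := eq_card1 y W.
    by apply: subset_card_le => _ ->.
  have [x1 xp] := SP _ Sx.
  have [t] : exists t, 2 - 1 / 2 < `|y t + x t|.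
    exact: Cnorm_gt (yx y erefl).
  have : -1 <= x t <= 1.
    by rewrite -ler_norml; apply: le_trans x1; exact: Cnorm_ub.
  have := y01 t; rewrite lter_normr.
  have [->|tp] := pselect (t = p).
    by move=> /andP[? ?] /andP[? ?] /orP[?|?]; lra.
  by rewrite yp// => _ /andP[? ?] /orP[?|?]; lra.
have [y yP] := peaks rF.
(* Signs are indexed by [nat], 0 for plus and all others for minus, to fit [card_le_setX_nat]. *)
pose z (Wn : set K * nat) : CK := if Wn.2 is 0%N then y Wn.1 else - y Wn.1.
have [p _] := K0; have [S sS SP] := slice_eval R cK p.
have [|||x Sx zx] := Dau (z @` (F `*` setT)) _ _ S sS (1 / 2).
- move=> _ [[W n] [/= FW _] <-]; have [y1 _ _] := yP _ FW.
  by case: n => [|n]; rewrite /z/unit_sphere/= ?normrN.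
- apply: card_le_trans (card_image_le _ _) _.
  apply: card_le_trans Fk; apply: card_le_setX_nat.
  exact: reaping_infinite.
- by lra.
have [x1 _] := SP _ Sx.
apply: (@reaping_no_oscillation F y x) => // W FW; split.
  have := zx (y W); rewrite (_ : 2 - 1 / 2 = 3 / 2); last by lra.
  by apply; exists (W, 0%N).
have := zx (- y W); rewrite (_ : 2 - 1 / 2 = 3 / 2); last by lra.
by rewrite -opprB normrN addrC; apply; exists (W, 1%N).
Qed.

(** The norm is attained at some [t]; the value -2 is excluded by y >= 0 and x >= -1, so y(t) = x(t)
    = 1 and t = p. *)
Lemma peak_norm2 (p : K) (y x : CK) :
  (forall t, 0 <= y t) -> (forall t, 1 <= y t -> t = p) ->
  `|y| = 1 -> `|x| <= 1 -> `|y + x| = 2 -> x p = 1.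
Proof.
move=> y0 yp y1 x1 yx.
have [t yxt] : exists t, `|y + x| = `|y t + x t| by exact: Cnorm_attained.
rewrite yx in yxt.
have : -1 <= x t <= 1.
  by rewrite -ler_norml; apply: le_trans x1; exact: Cnorm_ub.
have yt1 : y t <= 1.
  by rewrite -y1; apply: le_trans (ler_norm _) _; exact: Cnorm_ub.
move=> /andP[xt0 xt1]; have yt0 := y0 t.
have yxt2 : y t + x t = 2.
  by move: yxt; case: ler0P => *; lra.
have tp : t = p by apply: yp; lra.
by rewrite tp in yxt2 yt1 xt1; lra.
Qed.

Lemma Gdelta_point_not_perfect (p : K) :
  Gdelta [set p] -> ~ perfect_Daugavet CK 'I_1.
Proof.
move=> Gp pD; have [y [y1 y0 yp]] := Gdelta_point_peak R hK cK Gp.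
have [S sS SP] := slice_eval R cK p.
have [||x Sx yx] := pD [set y] _ _ S sS.
- by move=> _ ->.
- rewrite -(card_le_eqr card_II).
  by have /card_eqPle[] := @card_set1 _ y.
have [x1 xp] := SP _ Sx.
by have := peak_norm2 y0 yp y1 x1 (yx y erefl); lra.
Qed.

Lemma Gdelta_point_not_rigid (p : K) :
  Gdelta [set p] -> ~ rigid_octahedral CK 'I_1.
Proof.
move=> Gp rO; have [y [y1 y0 yp]] := Gdelta_point_peak R hK cK Gp.
have [||x x1 yx] := rO [set y].
- by move=> _ ->.
- rewrite -(card_le_eqr card_II).
  by have /card_eqPle[] := @card_set1 _ y.
have [yx1 yx2] := yx y erefl.
have x1' : `|x| <= 1 by rewrite x1.
have Nx1 : `|- x| <= 1 by rewrite normrN.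
have xp : x p = 1 by exact: peak_norm2 yx1.
have Nxp : - x p = 1 by exact: (peak_norm2 (x := - x)) yx2.
by move: Nxp; rewrite xp; lra.
Qed.

End Octahedrality.

(** * Lower bounds: splitting yields the four properties *)

Section LowerBounds.
Context (R : realType) (K : topologicalType).
Hypotheses (hK : hausdorff_space K) (cK : compact [set: K]).
Hypothesis K0 : [set: K] !=set0.
Local Notation CK := (@Cspace R K cK).

Lemma Gdelta_level (g : K -> R) (c : R) :
  continuous g -> Gdelta [set t | g t = c].
Proof.
move=> cg; exists (fun n => [set t | `|g t - c| < n.+1%:R^-1]).
  move=> n.
  rewrite (_ : mkset _ =
    (fun t => `|g t - c|) @^-1` [set u | u < n.+1%:R^-1])//.
  apply: open_comp; last exact: open_lt.
  move=> t _; apply: cvg_norm; apply: cvgB; [exact: cg|exact: cvg_cst].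
apply/seteqP; split=> [t /= gtc n _ /=|t /= gt].
  by rewrite gtc subrr normr0 invr_gt0.
apply/eqP; rewrite -subr_eq0 -normr_eq0 eq_le normr_ge0 andbT.
apply/ler_addgt0Pr => e e0; rewrite add0r.
have [n ne] : exists n : nat, n.+1%:R^-1 < e.
  exists (Num.bound e^-1).
  rewrite invf_plt ?posrE// (lt_trans (archi_boundP _))//.
    by rewrite invr_ge0 ltW.
  by rewrite ltr_nat.
by apply/ltW; apply: lt_trans ne; exact: gt.
Qed.

Section Attaining.
Variables (C : set (set K)) (Y : set CK) (r : R).
Hypothesis CI : forall A U, C A -> open U -> C (A `&` U).
Hypothesis CY : splits C Y.
Hypothesis YW : forall y, Y y -> exists W : set K, exists s : bool,
  [/\ C W, W !=set0 & forall t, W t -> r <= (-1) ^+ s * y t].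

(** The sign of [y] decides which of the two points shows the norm: [t] for plus, [u] for minus. *)
Lemma norm_ge_signed (y x : CK) (s : bool) (t u : K) :
  r <= (-1) ^+ s * y t -> r <= (-1) ^+ s * y u -> x t = 1 -> x u = -1 ->
  1 + r <= `|y + x|.
Proof.
move=> yt yu xt xu; case: s yt yu => /=.
  rewrite expr1 !mulN1r => _ yu; apply: le_trans (Cnorm_ub _ u).
  rewrite -[X in _ <= X]/(`|y u + x u|) xu.
  by rewrite ler_normr; apply/orP; right; lra.
rewrite expr0 !mul1r => yt _; apply: le_trans (Cnorm_ub _ t).
rewrite -[X in _ <= X]/(`|y t + x t|) xt.
by rewrite ler_normr; apply/orP; left; lra.
Qed.

Lemma slice_norm_ge (S : set CK) : slice S ->
  exists2 x : CK, S x &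
    forall y, Y y -> [/\ 1 <= `|x|, 1 + r <= `|y + x| & 1 + r <= `|y - x|].
Proof.
move=> sS.
have /choice[W WP] : forall y, exists W : set K, Y y ->
    (C W /\ W !=set0) /\ exists s : bool, forall t, W t -> r <= (-1) ^+ s * y t.
  move=> y; have [Yy|nYy] := pselect (Y y); last by exists set0.
  by have [W [s [CW W0 Ws]]] := YW Yy; exists W => _; split=> //; exists s.
have WC y : Y y -> C (W y) /\ W y !=set0 by move=> /WP[].
have [x Sx xP] := slice_attains hK CI CY WC sS.
exists x => // y Yy; have [_ [s ys]] := WP _ Yy.
have [[t Wt xt] [u Wu xu]] := xP _ Yy.
split; first by apply: le_trans (Cnorm_ub x t); rewrite xt normr1.
   exact: norm_ge_signed (ys _ Wt) (ys _ Wu) xt xu.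
apply: (norm_ge_signed (x := - x) (ys _ Wu) (ys _ Wt)).
  by rewrite -[LHS]/(- x u) xu opprK.
by rewrite -[LHS]/(- x t) xt.
Qed.

(** A function found in an arbitrary slice has norm exactly 1, as it attains 1 on some [W y]; if [Y]
    is empty, the constant 1 serves. *)
Lemma sphere_norm_ge : exists2 x : CK, `|x| = 1 &
  forall y, Y y -> 1 + r <= `|y + x| /\ 1 + r <= `|y - x|.
Proof.
have [p _] := K0.
have [[y Yy]|Y0] := pselect (Y !=set0); last first.
  exists (Ccst cK 1); last by move=> y Yy; case: Y0; exists y.
  by apply: (@Cnorm_eq1 _ _ _ _ p) => [s|]; rewrite normr1.
have [S sS SP] := slice_eval R cK p.
have [x Sx xP] := slice_norm_ge sS; exists x.
  by apply/eqP; rewrite eq_le (SP _ Sx).1; have [-> _ _] := xP _ Yy.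
by move=> z /xP[].
Qed.

End Attaining.

Lemma sphere_sign (y : CK) : `|y| = 1 ->
  exists t, exists s : bool, (-1) ^+ s * y t = 1.
Proof.
have [t ->] := Cnorm_attained y K0; rewrite -[X in X = _ -> _]/(`|y t|) => yt.
exists t, (y t < 0); move: yt; case: ltrP => y0.
  by rewrite ltr0_norm// expr1 mulN1r.
by rewrite ger0_norm// expr0 mul1r.
Qed.

Lemma sign_continuous (y : CK) (s : bool) :
  continuous (fun t => (-1) ^+ s * y t).
Proof.
by move=> t; apply: cvgM; [exact: cvg_cst|exact: Cspace_continuous].
Qed.

Lemma open_signed_sets (Y : set CK) (r : R) :
  Y `<=` unit_sphere (X := CK) -> r < 1 ->
  forall y, Y y -> exists W : set K, exists s : bool,
  [/\ open W, W !=set0 & forall t, W t -> r <= (-1) ^+ s * y t].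
Proof.
move=> Y1 r1 y /Y1 /sphere_sign[t [s yt]].
exists ((fun t => (-1) ^+ s * y t) @^-1` [set u | r < u]), s; split.
- apply: open_comp; last exact: open_gt.
  by move=> u _; exact: sign_continuous.
- by exists t; rewrite /= yt.
- by move=> u /= /ltW.
Qed.

Lemma Gdelta_signed_sets (Y : set CK) :
  Y `<=` unit_sphere (X := CK) ->
  forall y, Y y -> exists W : set K, exists s : bool,
  [/\ Gdelta W, W !=set0 & forall t, W t -> 1 <= (-1) ^+ s * y t].
Proof.
move=> Y1 y /Y1 /sphere_sign[t [s yt]].
exists [set t | (-1) ^+ s * y t = 1], s; split.
- by apply: Gdelta_level; exact: sign_continuous.
- by exists t.
- by move=> u /= ->.
Qed.

Lemma splits_Daugavet (l : cardinal) :
  (forall Y : set CK, Y #<= [set: l] -> splits (@open K) Y) -> Daugavet CK l.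
Proof.
move=> Yspl Y Y1 Yl S sS e e0.
(* This choice of [r] gives 1 + r = 2 - e/2 > 2 - e. *)
have r1 : 1 - e / 2 < 1 by lra.
have [x Sx xP] :=
  slice_norm_ge (@openI K) (Yspl _ Yl) (open_signed_sets Y1 r1) sS.
exists x => // y /xP[_ + _]; apply: lt_le_trans; lra.
Qed.

Lemma splits_octahedral (l : cardinal) :
  (forall Y : set CK, Y #<= [set: l] -> splits (@open K) Y) -> octahedral CK l.
Proof.
move=> Yspl Y Y1 Yl e e0.
have r1 : 1 - e / 2 < 1 by lra.
have [x x1 xP] :=
  sphere_norm_ge (@openI K) (Yspl _ Yl) (open_signed_sets Y1 r1).
exists x => // y /xP[y1 y2].
by split; [apply: lt_le_trans y1|apply: lt_le_trans y2]; lra.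
Qed.

Lemma splits_perfect_Daugavet (l : cardinal) :
  (forall Y : set CK, Y #<= [set: l] -> splits (@Gdelta K) Y) ->
  perfect_Daugavet CK l.
Proof.
move=> Yspl Y Y1 Yl S sS.
have [x Sx xP] :=
  slice_norm_ge (@Gdelta_openI K) (Yspl _ Yl) (Gdelta_signed_sets Y1) sS.
have x1 : `|x| <= 1 by move: sS Sx => [f [a [_ _ ->]]] [].
exists x => // y Yy; have [_ yx _] := xP _ Yy.
apply/eqP; rewrite eq_le yx andbT (le_trans (ler_normD _ _))//.
by rewrite (Y1 _ Yy) lerD2l.
Qed.

Lemma splits_rigid_octahedral (l : cardinal) :
  (forall Y : set CK, Y #<= [set: l] -> splits (@Gdelta K) Y) ->
  rigid_octahedral CK l.
Proof.
move=> Yspl Y Y1 Yl.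
have [x x1 xP] :=
  sphere_norm_ge (@Gdelta_openI K) (Yspl _ Yl) (Gdelta_signed_sets Y1).
exists x => // y Yy; have [yx1 yx2] := xP _ Yy.
have y1 : `|y| = 1 := Y1 _ Yy.
split; apply/eqP; rewrite eq_le.
  by rewrite yx1 andbT (le_trans (ler_normD _ _))// y1 x1.
by rewrite yx2 andbT (le_trans (ler_normB _ _))// y1 x1.
Qed.

End LowerBounds.

(** * The invariants as values of the reaping number *)

Section Invariants.
Context (R : realType) (K : topologicalType).
Hypotheses (hK : hausdorff_space K) (cK : compact [set: K]).
Hypothesis K0 : [set: K] !=set0.
Local Notation CK := (@Cspace R K cK).

Lemma reaping_number_exists : exists k, is_reaping_number K k.
Proof.
have [|F rF Fmin] := @exists_least_card _ [set F : set (set K) | reaping F].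
  (* All nonempty open sets form a reaping family: the complement of [L1] misses [L1], and if it is
     empty then so is [L2]. *)
  exists [set W : set K | open W /\ W !=set0]; split=> // L1 L2 c1 c2 L12.
  have [L1T|/set0P L1n] := eqVneq (~` L1) set0.
    have L20 : L2 = set0.
      by rewrite -L12 -(setCK L1) L1T setC0 setTI.
    by exists setT; [split; [exact: openT|]|right; rewrite L20 setI0].
  exists (~` L1); first by split=> //; exact: closed_openC.
  by left; rewrite setICl.
exists F; split; first by exists F => //; exact: card_setT_sym.
move=> l [F' rF' F'l]; have FF' := Fmin _ rF'.
rewrite (card_le_eql (card_setT F)).
by apply: card_le_trans FF' _; have /card_eqPle[] := F'l.
Qed.

Variable k : cardinal.
Hypothesis rk : is_reaping_number K k.

Lemma reaping_gt (l : cardinal) : ~ ([set: k] #<= [set: l]) ->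
  forall F : set (set K), reaping F -> ~ (F #<= [set: l]).
Proof.
move=> kl F rF Fl; apply: kl; apply: card_le_trans Fl.
rewrite -(card_le_eqr (card_setT F)); apply: rk.2.
by exists F => //; exact: card_setT_sym.
Qed.

Lemma is_Dau_reaping : is_Dau CK k.
Proof.
have [[F rF /card_eqPle[Fk _]] _] := rk.
split=> [|l nD]; first exact: reaping_not_Daugavet rF Fk.
apply: contrapT => kl; apply: nD; apply: splits_Daugavet => // Y Yl.
exact: splits_open (reaping_gt kl) Yl.
Qed.

Lemma is_oct_reaping : is_oct CK k.
Proof.
have [[F rF /card_eqPle[Fk _]] _] := rk.
split=> [|l nO]; first exact: reaping_not_octahedral rF Fk.
apply: contrapT => kl; apply: nO; apply: splits_octahedral => // Y Yl.
exact: splits_open (reaping_gt kl) Yl.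
Qed.

(** The case of the cardinal 0, the only one below 1. *)
Lemma splits_set0 (C : set (set K)) (I : choiceType) (Y : set I) (T : Type) :
  Y #<= [set: T] -> ~ inhabited T -> splits C Y.
Proof.
move=> YT nT W _; exists set0, set0.
split; [exact: closed0|exact: closed0|exact: setI0|move=> y Yy].
exfalso; apply: nT.
have /card_leP[f] := YT.
by have t : T := \val (f (SigSub (mem_set Yy))); constructor.
Qed.

(** With an isolated point the reaping number is at most 1, so [l] is empty; without one there is no
    G_delta-point either. *)
Lemma splits_Gdelta_reaping (l : cardinal) (Y : set CK) :
  ~ (has_Gdelta_point K /\ ~ has_isolated_point K) ->
  ~ ([set: k] #<= [set: l]) -> Y #<= [set: l] -> splits (@Gdelta K) Y.
Proof.
move=> nexc kl Yl.
have [[p ip]|ni] := pselect (has_isolated_point K); last first.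
  by apply: (splits_Gdelta hK cK _ (reaping_gt kl) Yl) => G; exact: nexc.
apply: splits_set0 Yl _ => -[x].
apply: (reaping_gt kl (isolated_reaping ip)).
apply: (@card_le_trans _ _ _ [set x]); last exact: card_leT.
by have /card_eqPle[] := eq_card1 [set p] x.
Qed.

Lemma is_pDau_reaping :
  ~ (has_Gdelta_point K /\ ~ has_isolated_point K) -> is_pDau CK k.
Proof.
move=> nexc; have [nD _] := is_Dau_reaping.
split=> [pD|l npD].
  apply: nD => Y Y1 Yk S sS e e0; have [x Sx xY] := pD Y Y1 Yk S sS.
  by exists x => // y /xY ->; lra.
apply: contrapT => kl; apply: npD; apply: splits_perfect_Daugavet => // Y Yl.
exact: splits_Gdelta_reaping kl Yl.
Qed.

Lemma is_rig_oct_reaping :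
  ~ (has_Gdelta_point K /\ ~ has_isolated_point K) -> is_rig_oct CK k.
Proof.
move=> nexc; have [nO _] := is_oct_reaping.
split=> [rO|l nrO].
  apply: nO => Y Y1 Yk e e0; have [x x1 xY] := rO Y Y1 Yk.
  by exists x => // y /xY[-> ->]; split; lra.
apply: contrapT => kl; apply: nrO; apply: splits_rigid_octahedral => // Y Yl.
exact: splits_Gdelta_reaping kl Yl.
Qed.

End Invariants.

(** * Spaces with a G_delta-point and no isolated point *)

Section Exceptional.
Context (R : realType) (K : topologicalType).
Hypotheses (hK : hausdorff_space K) (cK : compact [set: K]).
Hypothesis K0 : [set: K] !=set0.
Hypotheses (GK : has_Gdelta_point K) (iK : ~ has_isolated_point K).
Local Notation CK := (@Cspace R K cK).

Lemma reaping_number_nat : is_reaping_number K nat.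
Proof.
have [p Gp] := GK; have [F rF cF] := Gdelta_point_reaping hK cK Gp.
split=> [|l [F' rF' /card_eqPle[F'l _]]].
  by exists F => //; apply: eq_card_nat => //; exact: reaping_infinite rF.
apply: card_le_trans F'l; apply/infiniteP; exact: reaping_infinite rF'.
Qed.

Lemma card_le_ord1 (l : cardinal) :
  ~ ([set: 'I_1] #<= [set: l]) -> ~ inhabited l.
Proof.
move=> nl [x]; apply: nl.
rewrite -(card_le_eql card_II); apply: (@card_le_trans _ _ _ [set x]).
  by have /card_eqPle[] := @card_set1 _ x.
exact: card_leT.
Qed.

Lemma is_pDau_ord1 : is_pDau CK 'I_1.
Proof.
have [p Gp] := GK; split=> [|l npD]; first exact: Gdelta_point_not_perfect Gp.
apply: contrapT => /card_le_ord1 nl; apply: npD.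
apply: splits_perfect_Daugavet => // Y Yl; exact: splits_set0 Yl nl.
Qed.

Lemma is_rig_oct_ord1 : is_rig_oct CK 'I_1.
Proof.
have [p Gp] := GK; split=> [|l nrO]; first exact: Gdelta_point_not_rigid Gp.
apply: contrapT => /card_le_ord1 nl; apply: nrO.
apply: splits_rigid_octahedral => // Y Yl; exact: splits_set0 Yl nl.
Qed.

End Exceptional.

(** [K0] says that C(K) is nonzero, as the invariants require. A common value [k] expresses the
    equalities; ['I_1] and [nat] stand for 1 and omega. *)
Theorem theorem4p5 (R : realType) (K : topologicalType)
    (hK : hausdorff_space K) (cK : compact [set: K]) (K0 : [set: K] !=set0) :
  let CK : completeNormedModType R := Cspace R cK in
  let exceptional := has_Gdelta_point K /\ ~ has_isolated_point K in
  (~ exceptional ->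
    exists k : cardinal,
      [/\ is_pDau CK k, is_Dau CK k, is_oct CK k, is_rig_oct CK k &
          is_reaping_number K k]) /\
  (exceptional ->
    [/\ is_pDau CK 'I_1 /\ is_rig_oct CK 'I_1,
        [set: 'I_1] #<= [set: nat] /\ ~ ([set: nat] #<= [set: 'I_1]) &
        [/\ is_Dau CK nat, is_oct CK nat & is_reaping_number K nat]]).
Proof.
split=> [nexc|[GK iK]].
  have [k rk] := reaping_number_exists K0.
  exists k; split=> //.
  - exact: is_pDau_reaping.
  - exact: is_Dau_reaping.
  - exact: is_oct_reaping.
  - exact: is_rig_oct_reaping.
have rN := reaping_number_nat hK cK GK iK.
split.
- by split; [exact: is_pDau_ord1|exact: is_rig_oct_ord1].
- split; first exact: countableP.
  by move=> /infiniteP; apply; exact: finite_finset.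
- by split; [exact: is_Dau_reaping|exact: is_oct_reaping|].
Qed.
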